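(* Let $R=k[x_1,\dots,x_m]$ be a polynomial ring over a field $k$, and let $I$ and $J$ be monomial ideals of $R$. Let $f$ be the least common multiple of the minimal generating monomials of $I$, and for $n\ge1$ let $I^{(n)}=\bigcup_{r\ge0}(I^n:J^r)$. Then for all $n\ge1$, $$\operatorname{reg}(I^{(n)})\le(\deg f)n-\operatorname{ht}I+1.$$
   Context: For a finitely generated graded $R$-module $E$, with $\mathfrak m=(x_1,\dots,x_m)$, $a_i(E)=\max\{r: H^i_{\mathfrak m}(E)_r\neq0\}$ ($-\infty$ if the module vanishes) and $\operatorname{reg}(E)=\max_i\{a_i(E)+i\}$; the regularity of an ideal is its regularity as a graded module. $\operatorname{ht}I$ is the height of $I$. *)

(* Defs.v *)
From HB Require Import structures.
From mathcomp Require Import all_boot all_order all_algebra.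
From mathcomp Require Import mpoly.
Set Implicit Arguments. Unset Strict Implicit. Unset Printing Implicit Defensive.
Import Order.TTheory GRing.Theory Num.Theory.
Local Open Scope ring_scope.

Section Defs.
Variables (k : fieldType) (m : nat).
Local Notation R := {mpoly k[m]}.

Definition is_ideal (I : R -> Prop) : Prop :=
  [/\ I 0, (forall p q, I p -> I q -> I (p + q)) & (forall a p, I p -> I (a * p))].

Definition ideal_gen (S : R -> Prop) (p : R) : Prop :=
  exists (s c : seq R), (forall x, x \in s -> S x) /\
    p = \sum_(i < size s) c`_i * s`_i.

Definition monomial_ideal (I : R -> Prop) : Prop :=
  is_ideal I /\ exists M : 'X_{1..m} -> Prop,
    forall p, I p <-> ideal_gen (fun q => exists mu, M mu /\ q = 'X_[mu]) p.

Definition min_gen_monomial (I : R -> Prop) (mu : 'X_{1..m}) : Prop :=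
  I 'X_[mu] /\ forall nu : 'X_{1..m}, I 'X_[nu] -> (nu <= mu)%MM -> nu = mu.

Definition lcm_mono (s : seq 'X_{1..m}) : 'X_{1..m} :=
  [multinom (\max_(mu <- s) mu i)%N | i < m].

Definition ideal_pow (I : R -> Prop) (n : nat) : R -> Prop :=
  ideal_gen (fun q => exists s : seq R,
     size s = n /\ (forall x, x \in s -> I x) /\ q = \prod_(x <- s) x).

Definition colon (A B : R -> Prop) (p : R) : Prop :=
  forall q, B q -> A (p * q).

Definition sat_pow (I J : R -> Prop) (n : nat) (p : R) : Prop :=
  exists r : nat, colon (ideal_pow I n) (ideal_pow J r) p.

Definition prime_ideal (P : R -> Prop) : Prop :=
  [/\ is_ideal P, ~ P 1 & forall a b, P (a * b) -> P a \/ P b].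

Definition strict_sub (A B : R -> Prop) : Prop :=
  (forall p, A p -> B p) /\ exists p, B p /\ ~ A p.

Definition prime_chain_to (P : R -> Prop) (h : nat) : Prop :=
  exists Q : nat -> (R -> Prop),
    [/\ forall j, (j <= h)%N -> prime_ideal (Q j),
        forall j, (j < h)%N -> strict_sub (Q j) (Q j.+1)
      & forall p, Q h p <-> P p].

Definition ht_ge (I : R -> Prop) (h : nat) : Prop :=
  forall P, prime_ideal P -> (forall p, I p -> P p) -> prime_chain_to P h.

Definition is_height (I : R -> Prop) (h : nat) : Prop :=
  ht_ge I h /\ ~ ht_ge I h.+1.

Definition xF (F : {set 'I_m}) : R := \prod_(j in F) 'X_j.

(* A cochain is represented by (c, t): its F-component is the fraction
   c F / x_F^t in the localization E_{x_F}, with c F in E.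
   Cech differential: (dc)_G = sum_{j in G} (-1)^{pos} c_{G\j}/x_{G\j}^t
   = (sum_{j in G} (-1)^{pos} c_{G\j} x_j^t) / x_G^t. *)
Definition cech_d (c : {set 'I_m} -> R) (t : nat) (G : {set 'I_m}) : R :=
  \sum_(j in G) (-1) ^+ #|[set l in G | (l < j)%N]| * c (G :\ j) * 'X_j ^+ t.

(* (c,t) is a cochain of E supported on the F with P #|F|, all of whose
   components are homogeneous of degree r (deg c_F - t|F| = r). *)
Definition cochain (E : R -> Prop) (P : nat -> bool) (r : int)
    (c : {set 'I_m} -> R) (t : nat) : Prop :=
  forall F : {set 'I_m},
    [/\ ~~ P #|F| -> c F = 0, E (c F)
      & c F = 0 \/ exists d : nat,
          d%:Z = r + (t * #|F|)%N%:Z /\ c F \is d.-homog].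

(* H^i_m(E)_r <> 0 : a degree-r cocycle in C^i which is not a coboundary
   (fractions a/x_F^t and b/x_F^s are equal iff a x_F^s = b x_F^t) *)
Definition loccoh_nonzero (E : R -> Prop) (i : nat) (r : int) : Prop :=
  exists (c : {set 'I_m} -> R) (t : nat),
    [/\ cochain E (fun n => n == i) r c t,
        forall G, cech_d c t G = 0
      & ~ exists (b : {set 'I_m} -> R) (s : nat),
            cochain E (fun n => n.+1 == i) r b s /\
            forall F, c F * xF F ^+ s = cech_d b s F * xF F ^+ t].

Definition reg_le (E : R -> Prop) (B : int) : Prop :=
  forall (i : nat) (r : int), loccoh_nonzero E i r -> r + i%:Z <= B.

End Defs.

(* Main.v *)
(* A monomial of E = I^(n) may be truncated at a := n.f without leaving E, so in
   multidegree alpha the Cech complex of E is a cone with apex v as soon as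
   alpha_v >= a_v: toggling v does not affect membership in E_{x_F}. If
   alpha_v < a_v for all v, then |alpha| <= |a| - m; moreover x_F^N lies in E
   whenever #|F| > m - ht I (otherwise E is contained in a prime generated by
   fewer than ht I variables), so in cohomological degree i > m - ht I + 1 any v
   with alpha_v >= 0 is again an apex. The remaining multidegrees satisfy
   |alpha| + i <= |a| - ht I + 1, or have alpha < 0 and i = m; there
   |alpha| + i <= 0, and ht I <= |a| as I lies in the prime generated by the
   variables dividing f. That a prime generated by s variables has height at
   most s follows by counting: along a chain of primes, powers of an element of
   Q' outside Q multiply a family independent modulo Q' into one independent
   modulo Q, so a chain of length e yields N^e independent polynomials of degree
   O(N), which forces e <= m. *)
Require Import Defs.
From HB Require Import structures.
From mathcomp Require Import all_boot all_order all_algebra.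
From mathcomp Require Import mpoly zify.
From Stdlib Require Import Classical.
Set Implicit Arguments. Unset Strict Implicit. Unset Printing Implicit Defensive.
Import Order.TTheory GRing.Theory Num.Theory.
Local Open Scope ring_scope.

(** * Primes generated by variables *)

Section Ideals.
Variables (k : fieldType) (m : nat).
Local Notation R := {mpoly k[m]}.
Implicit Types (Q : R -> Prop).

Lemma ideal_sum Q (T : Type) (s : seq T) (P : pred T) (F : T -> R) :
  is_ideal Q -> (forall i, P i -> Q (F i)) -> Q (\sum_(i <- s | P i) F i).
Proof. by move=> [Q0 QD _] QF; elim/big_ind: _. Qed.

Lemma idealZ Q (c : k) p : is_ideal Q -> Q p -> Q (c *: p).
Proof. by move=> [_ _ QM] Qp; rewrite -mul_mpolyC; apply: QM. Qed.

Lemma idealB Q p q : is_ideal Q -> Q (p + q) -> Q p -> Q q.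
Proof.
move=> [_ QD QM] Qpq Qp; have -> : q = (p + q) + (-1) * p.
  by rewrite mulN1r addrAC subrr add0r.
exact: QD (QM _ _ Qp).
Qed.

(** * Linear independence modulo an ideal and growth of quotients *)

Definition lin_indep_mod Q (L : seq R) : Prop :=
  forall c : nat -> k, Q (\sum_(l < size L) c l *: L`_l) ->
  forall l, (l < size L)%N -> c l = 0.

Fixpoint power_translates (f : R) (L : seq R) (N : nat) : seq R :=
  if N is N'.+1 then L ++ [seq f * g | g <- power_translates f L N'] else [::].

Lemma size_power_translates f L N :
  size (power_translates f L N) = (N * size L)%N.
Proof. by elim: N => //= N IH; rewrite size_cat size_map IH mulSn. Qed.

(** Modulo [Q'] a relation involves [L] alone, as [f] lies in [Q'], so the coefficients on [L]
    vanish. What remains is [f] times a combination, and primality of [Q] cancels [f]. *)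
Lemma lin_indep_power_translates Q Q' f L N :
    prime_ideal Q -> is_ideal Q' -> (forall p, Q p -> Q' p) ->
    Q' f -> ~ Q f -> lin_indep_mod Q' L ->
  lin_indep_mod Q (power_translates f L N).
Proof.
move=> [idQ _ prQ] idQ' sub Q'f Qf indL; elim: N => [|N IH] //= c.
set L' := power_translates f L N in IH *.
rewrite size_cat size_map big_split_ord /=.
have -> : \sum_(i < size L) c i *: (L ++ [seq f * g | g <- L'])`_i =
    \sum_(i < size L) c i *: L`_i.
  by apply: eq_bigr => i _; rewrite nth_cat ltn_ord.
have -> : \sum_(i < size L') c (size L + i)%N *:
      (L ++ [seq f * g | g <- L'])`_(size L + i) =
    f * \sum_(i < size L') c (size L + i)%N *: L'`_i.
  rewrite mulr_sumr; apply: eq_bigr => i _.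
  by rewrite nth_cat ltnNge leq_addr /= addKn (nth_map 0) // scalerAr.
move=> Qs.
have cL l : (l < size L)%N -> c l = 0.
  apply: indL; apply: (idealB idQ' (p := f * (\sum_(i < size L') c (size L + i)%N *: L'`_i))).
    by rewrite addrC; apply: sub.
  by case: idQ' => _ _ QM; rewrite mulrC; apply: QM.
rewrite big1 in Qs; last by move=> i _; rewrite cL ?scale0r.
rewrite add0r in Qs; case: (prQ _ _ Qs) => // QL' l hl.
have [/cL //|hl'] := ltnP l (size L).
rewrite -(subnKC hl'); apply: (IH (fun i => c (size L + i)%N)) => //.
by rewrite ltn_subLR.
Qed.

Lemma deg_power_translates f L N d e :
    (forall nu, nu \in msupp f -> (mdeg nu <= d)%N) ->
    (forall g nu, g \in L -> nu \in msupp g -> (mdeg nu <= e)%N) ->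
  forall g nu, g \in power_translates f L N -> nu \in msupp g ->
    (mdeg nu <= d * N + e)%N.
Proof.
move=> fd Le; elim: N => //= N IH g nu; rewrite mem_cat => /orP[gL /(Le _ _ gL)|].
  by move/leq_trans; apply; rewrite leq_addl.
case/mapP => g' g'L -> /msuppM_le /allpairsP[[x y] /= [xf yg ->]].
by rewrite mdegD mulnS -addnA leq_add ?fd // (IH g').
Qed.

(** Exponents at most [d] allow [d.+1 ^ m] monomials; a longer family has a coefficient matrix with
    nonzero left kernel, hence a nontrivial combination equal to [0]. *)
Lemma lin_indep_size Q L d : is_ideal Q -> lin_indep_mod Q L ->
    (forall g nu, g \in L -> nu \in msupp g -> (mdeg nu <= d)%N) ->
  (size L <= d.+1 ^ m)%N.
Proof.
move=> [Q0 _ _] indL Ld; rewrite leqNgt; apply/negP => lt.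
pose T := {ffun 'I_m -> 'I_d.+1}.
have cT : #|T| = (d.+1 ^ m)%N by rewrite card_ffun !card_ord.
pose A := \matrix_(i < size L, j < #|T|) (L`_i)@_[multinom (enum_val j i : nat) | i < m].
have : kermx A != 0.
  rewrite -mxrank_eq0 mxrank_ker -lt0n subn_gt0.
  by apply: leq_ltn_trans (rank_leq_col _) _; rewrite cT.
move/rowV0Pn => [v /sub_kermxP vA v0]; case/negP: v0; apply/eqP/rowP => i; rewrite mxE.
pose c (l : nat) := if insub l is Some j then v 0 j else 0.
have cE j : c (nat_of_ord j) = v 0 j by rewrite /c valK.
rewrite -cE; apply: indL => //.
suff -> : \sum_(l < size L) c l *: L`_l = 0 by [].
apply/mpolyP => nu; rewrite mcoeff0 raddf_sum /=.
have [le|gt] := leqP (mdeg nu) d.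
  have lt' j : (nu j < d.+1)%N.
    by rewrite ltnS; apply: leq_trans le; rewrite mdegE (bigD1 j) //= leq_addr.
  have /rowP/(_ (enum_rank [ffun j => Ordinal (lt' j)])) := vA.
  rewrite !mxE => vA0; rewrite -[RHS]vA0; apply: eq_bigr => l _.
  rewrite cE mcoeffZ mxE enum_rankK.
  by congr (_ * mcoeff _ _); apply/mnmP => j; rewrite mnmE ffunE.
apply: big1 => l _; rewrite mcoeffZ memN_msupp_eq0 ?mulr0 //.
by apply/negP => /Ld; rewrite mem_nth // leqNgt gt; move/(_ isT).
Qed.

(* The Hilbert function of the quotient by [Q] grows at least like [N ^ e]. *)
Definition growth_ge Q (e : nat) : Prop :=
  exists d : nat, forall N : nat, exists L : seq R,
    [/\ size L = (N ^ e)%N, lin_indep_mod Q L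
      & forall g nu, g \in L -> nu \in msupp g -> (mdeg nu <= d * N)%N].

Lemma growth_ge0 Q : is_ideal Q -> ~ Q 1 -> growth_ge Q 0.
Proof.
move=> idQ Q1; exists 0%N => N; exists [:: 1]; split=> //.
  move=> c; rewrite big_ord1 /= => Qc [|//] _.
  have [//|c0] := eqVneq (c 0%N) 0; case: Q1.
  by rewrite -[1]scale1r -(mulVf c0) -scalerA; apply: idealZ.
move=> g nu; rewrite inE => /eqP ->; rewrite msupp1 inE => /eqP ->.
by rewrite mdeg0.
Qed.

Lemma growth_geS Q Q' e : prime_ideal Q -> is_ideal Q' -> strict_sub Q Q' ->
  growth_ge Q' e -> growth_ge Q e.+1.
Proof.
move=> prQ idQ' [sub [f [Q'f Qf]]] [d gd].
pose df := \max_(nu <- msupp f) mdeg nu.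
exists (df + d)%N => N; have [L [sL iL dL]] := gd N.
exists (power_translates f L N); split.
- by rewrite size_power_translates sL expnS.
- exact: lin_indep_power_translates iL.
rewrite mulnDl; apply: deg_power_translates dL => nu nuf.
by rewrite /df (big_rem nu) //= leq_maxl.
Qed.

Lemma growth_ge_leq Q e : is_ideal Q -> growth_ge Q e -> (e <= m)%N.
Proof.
move=> idQ [d gd]; rewrite leqNgt; apply/negP => lt.
(* If [m < e], independence gives [N ^ m.+1 <= (d * N).+1 ^ m <= d.+1 ^ m * N ^ m], which fails once
   [N] exceeds [d.+1 ^ m]. *)
pose N := (d.+1 ^ m).+1; have [L [sL iL dL]] := gd N.
have := lin_indep_size idQ iL dL; rewrite sL leqNgt => /negP; apply.
apply: (@leq_ltn_trans ((d.+1 * N) ^ m)).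
  have : (d * N < d.+1 * N)%N by rewrite ltn_pmul2r.
  by case: (m) => // m1; rewrite leq_exp2r.
apply: (@leq_trans (N ^ m.+1)); last by rewrite leq_pexp2l.
by rewrite expnMn expnS ltn_pmul2r ?expn_gt0.
Qed.

Lemma growth_ge_sub Q Q' e : (forall p, Q p -> Q' p) ->
  growth_ge Q' e -> growth_ge Q e.
Proof.
move=> sub [d gd]; exists d => N; have [L [sL iL dL]] := gd N.
by exists L; split=> // c /sub; apply: iL.
Qed.

(** The ideal generated by the ['X_j] with [j] in [S], given through coefficients. It is the kernel
    of the substitution [kill_vars], hence prime. *)
Definition var_prime (S : {set 'I_m}) (p : R) : Prop :=
  forall nu : 'X_{1..m}, (forall j, j \in S -> nu j = 0%N) -> p@_nu = 0.

Definition kill_vars (S : {set 'I_m}) (p : R) : R :=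
  p \mPo [tuple if j \in S then 0 else 'X_j | j < m].

Lemma kill_varsX S (nu : 'X_{1..m}) :
  kill_vars S 'X_[nu] = if [forall j in S, nu j == 0%N] then 'X_[nu] else 0.
Proof.
rewrite /kill_vars comp_mpolyX; case: ifP => [/forall_inP nuS|/negbT].
  rewrite mpolyXE_id; apply: eq_bigr => j _; rewrite tnth_mktuple.
  by case: ifP => // /nuS /eqP ->; rewrite !expr0.
rewrite negb_forall_in => /existsP[j /andP[jS nuj]].
by rewrite (bigD1 j) //= tnth_mktuple jS expr0n (negPf nuj) mul0r.
Qed.

Lemma mcoeff_kill_vars S p (nu : 'X_{1..m}) :
  (kill_vars S p)@_nu = if [forall j in S, nu j == 0%N] then p@_nu else 0.
Proof.
have kE : (kill_vars S p)@_nu = \sum_(mu <- msupp p) p@_mu * (kill_vars S 'X_[mu])@_nu.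
  rewrite {1}[p]mpolyE /kill_vars (raddf_sum (comp_mpoly _)) raddf_sum /=.
  by apply: eq_bigr => mu _; rewrite comp_mpolyZ mcoeffZ.
rewrite kE; case: ifPn => nuS.
  rewrite [in RHS](mpolyE p) raddf_sum; apply: eq_bigr => mu _ /=.
  rewrite mcoeffZ kill_varsX mcoeffX; have [->|ne] := eqVneq mu nu.
    by rewrite nuS mcoeffX eqxx.
  by case: ifP => _; rewrite ?mcoeff0 // mcoeffX (negPf ne).
apply: big1 => mu _; rewrite kill_varsX; case: ifPn => [muS|_].
  by rewrite mcoeffX; case: eqP muS nuS => [-> -> //|_ _ _]; rewrite mulr0.
by rewrite mcoeff0 mulr0.
Qed.

Lemma var_primeP S p : var_prime S p <-> kill_vars S p = 0.
Proof.
split=> [Sp|kp nu nuS].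
  apply/mpolyP => nu; rewrite mcoeff_kill_vars mcoeff0.
  by case: ifP => // /forall_inP nuS; apply: Sp => j /nuS /eqP.
have := mcoeff_kill_vars S p nu; rewrite kp mcoeff0 ifT //.
by apply/forall_inP => j /nuS ->.
Qed.

Lemma var_prime_prime S : prime_ideal (var_prime S).
Proof.
split.
- split=> [nu _|p q Sp Sq nu nuS|a p]; first exact: mcoeff0.
    by rewrite mcoeffD Sp ?Sq ?addr0.
  by rewrite !var_primeP /kill_vars rmorphM /= => ->; rewrite mulr0.
- move/(_ 0%MM); rewrite mcoeff1 eqxx => /(_ (fun j _ => mnm0E j)) /eqP.
  by rewrite oner_eq0.
move=> a b; rewrite !var_primeP /kill_vars rmorphM /= => /eqP.
by rewrite mulf_eq0 => /orP[/eqP|/eqP]; [left|right].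
Qed.

(** Adjoining to [S] a variable outside it gives a strictly larger prime, so [growth_geS] gains one
    per such variable. *)
Lemma growth_ge_var_prime S : growth_ge (var_prime S) #|~: S|.
Proof.
move En: #|~: S| => n; elim: n S En => [|n IH] S cS; have [idS S1 _] := var_prime_prime S.
  by apply: growth_ge0.
have /card_gt0P[j] : (0 < #|~: S|)%N by rewrite cS.
rewrite inE => jS; pose S' := j |: S.
have cS' : #|~: S'| = n.
  have := cardsC S'; have := cardsC S; rewrite cS cardsU1 jS; lia.
have [idS' _ _] := var_prime_prime S'.
apply: (growth_geS (var_prime_prime S) idS') (IH _ cS').
split=> [p Sp nu nuS|]; first by apply: Sp => i iS; apply: nuS; rewrite inE iS orbT.
exists 'X_j; split=> [nu nuS|].
  rewrite mcoeffX; case: eqP => // Uj; have := nuS j (setU11 _ _).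
  by rewrite -Uj mnm1E eqxx.
move/(_ U_(j)%MM); rewrite mcoeffX eqxx => Uj0.
suff /Uj0/eqP : forall i, i \in S -> U_(j)%MM i = 0%N by rewrite oner_eq0.
by move=> i iS; rewrite mnm1E; case: eqP jS => // ->; rewrite iS.
Qed.

(** Going down the chain, each strict inclusion adds one to a growth exponent that starts at
    [m - #|S|] and cannot exceed [m]. *)
Lemma prime_chain_to_var_prime S h : prime_chain_to (var_prime S) h -> (h <= #|S|)%N.
Proof.
move=> [Q [prQ subQ Qh]].
have gQ j : (j <= h)%N -> growth_ge (Q (h - j)%N) (j + #|~: S|).
  elim: j => [|j IH] jh.
    by rewrite subn0; apply: growth_ge_sub (growth_ge_var_prime S) => p /Qh.
  have := subQ (h - j.+1)%N; rewrite -subSn // subSS => /(_ (leq_subr _ _)) sub.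
  have [id' _ _] := prQ (h - j)%N (leq_subr _ _).
  rewrite addSn; apply: (growth_geS (prQ _ (leq_subr _ _)) id' sub) (IH (ltnW jh)).
have := gQ h (leqnn h); rewrite subnn => g0.
have [id0 _ _] := prQ 0%N isT.
have := growth_ge_leq id0 g0; have := cardsC S; rewrite card_ord; lia.
Qed.

(** * Supports and truncation of monomial ideals *)

Implicit Types (A I J : R -> Prop) (nu mu a : 'X_{1..m}).

(** For an ideal this amounts to being monomial, in a form that passes to powers and saturations
    without choosing generators. *)
Definition supp_closed A : Prop :=
  forall p nu, A p -> nu \in msupp p -> A 'X_[nu].

Lemma ideal_mono_le A nu mu : is_ideal A -> (nu <= mu)%MM ->
  A 'X_[nu] -> A 'X_[mu].
Proof. by move=> [_ _ AM] /submK <- Anu; rewrite mpolyXD; apply: AM. Qed.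

Lemma ideal_gen_sub (G A : R -> Prop) p : is_ideal A ->
  (forall q, G q -> A q) -> ideal_gen G p -> A p.
Proof.
move=> idA GA [s [c [sG ->]]]; apply: ideal_sum => // i _.
by case: idA => _ _ AM; apply: AM; apply: GA; apply: sG; apply: mem_nth.
Qed.

Lemma ideal_gen_incl (G : R -> Prop) p : G p -> ideal_gen G p.
Proof.
move=> Gp; exists [:: p], [:: 1]; split=> [x|]; first by rewrite inE => /eqP ->.
by rewrite big_ord1 mul1r.
Qed.

Lemma ideal_gen_ideal (G : R -> Prop) : is_ideal (ideal_gen G).
Proof.
split=> [|p q [s [c [sG ->]]] [s' [c' [sG' ->]]]|a p [s [c [sG ->]]]].
- by exists [::], [::]; rewrite big_ord0.
- exists (s ++ s'), (mkseq (nth 0 c) (size s) ++ c'); split=> [x|].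
    by rewrite mem_cat => /orP[/sG|/sG'].
  rewrite size_cat big_split_ord /=; congr (_ + _); apply: eq_bigr => i _.
    by rewrite !nth_cat size_mkseq ltn_ord nth_mkseq.
  by rewrite !nth_cat size_mkseq ltnNge leq_addr /= addKn.
exists s, (mkseq (fun i => a * c`_i) (size s)); split=> //.
by rewrite mulr_sumr; apply: eq_bigr => i _; rewrite nth_mkseq // mulrA.
Qed.

Lemma ideal_gen_msupp (G : R -> Prop) p nu : ideal_gen G p -> nu \in msupp p ->
  exists q mu, [/\ G q, mu \in msupp q & (mu <= nu)%MM].
Proof.
move=> [s [c [sG ->]]] /msupp_sum_le/flattenP[/= x /mapP[i _ ->]].
move=> /msuppM_le/allpairsP[[u v] /= [uc vs ->]].
exists s`_i, v; split=> //; last exact: lem_addl.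
by apply: sG; apply: mem_nth.
Qed.

Lemma monomial_ideal_supp_closed I : monomial_ideal I -> supp_closed I.
Proof.
move=> [idI [M IM]] p nu /IM /ideal_gen_msupp gp /gp[q [mu [[mu' [Mmu' ->]]]]].
move=> /mem_msuppXP <- /ideal_mono_le; apply=> //; apply/IM/ideal_gen_incl.
by exists mu'.
Qed.

Lemma ideal_pow_ideal I n : is_ideal (ideal_pow I n).
Proof. exact: ideal_gen_ideal. Qed.

Lemma msupp_prod I (s : seq R) nu : supp_closed I -> (forall x, x \in s -> I x) ->
    nu \in msupp (\prod_(x <- s) x) ->
  exists t : seq 'X_{1..m}, [/\ size t = size s,
    forall u, u \in t -> I 'X_[u] & (\sum_(u <- t) u)%MM = nu].
Proof.
move=> cI; elim: s nu => [|x s IH] nu sI.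
  by rewrite big_nil msupp1 inE => /eqP ->; exists [::]; rewrite big_nil.
rewrite big_cons => /msuppM_le/allpairsP[[u v] /= [ux vs ->]].
have [|t [ts tI <-]] := IH v _ vs; first by move=> y ys; apply: sI; rewrite inE ys orbT.
exists (u :: t); split=> [|w|]; rewrite ?big_cons //= ?ts // inE => /predU1P[->|/tI//].
by apply: cI ux; apply: sI; rewrite inE eqxx.
Qed.

Lemma ideal_pow_msupp I n p nu : supp_closed I -> ideal_pow I n p ->
    nu \in msupp p ->
  exists t : seq 'X_{1..m}, [/\ size t = n,
    forall u, u \in t -> I 'X_[u] & (\sum_(u <- t) u <= nu)%MM].
Proof.
move=> cI /ideal_gen_msupp gp /gp[q [mu [[s [<- [sI ->]]] muq le]]].
by have [t [ts tI tE]] := msupp_prod cI sI muq; exists t; rewrite tE.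
Qed.

Lemma ideal_pow_mono I (t : seq 'X_{1..m}) nu :
    (forall u, u \in t -> I 'X_[u]) -> (\sum_(u <- t) u <= nu)%MM ->
  ideal_pow I (size t) 'X_[nu].
Proof.
move=> tI /ideal_mono_le; apply; first exact: ideal_pow_ideal.
apply: ideal_gen_incl; exists [seq 'X_[u] | u <- t]; rewrite size_map; split=> //.
split=> [x /mapP[u ut ->]|]; first exact: tI.
by rewrite big_map mpolyX_prod.
Qed.

Lemma ideal_pow_supp_closed I n : supp_closed I -> supp_closed (ideal_pow I n).
Proof.
move=> cI p nu Ip /(ideal_pow_msupp cI Ip)[t [<- tI tle]].
exact: ideal_pow_mono tle.
Qed.

Lemma ideal_pow_addl I r r' p : ideal_pow I (r + r') p -> ideal_pow I r p.
Proof.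
apply: ideal_gen_sub => [|q [s [ss [sI ->]]]]; first exact: ideal_pow_ideal.
rewrite -(cat_take_drop r s) big_cat /= mulrC.
have [_ _ PM] := ideal_pow_ideal I r; apply: PM; apply: ideal_gen_incl.
exists (take r s); split; last by split=> // x /mem_take/sI.
by rewrite size_takel // ss leq_addr.
Qed.

Lemma sat_pow_ideal I J n : is_ideal (sat_pow I J n).
Proof.
have [I0 ID IM] := ideal_pow_ideal I n.
split=> [|p q [r pr] [r' qr']|a p [r pr]].
- by exists 0%N => q _; rewrite mul0r.
- exists (r + r')%N => x Jx; rewrite mulrDl; apply: ID.
    by apply: pr; apply: ideal_pow_addl Jx.
  by apply: qr'; rewrite addnC in Jx; apply: ideal_pow_addl Jx.
by exists r => x /pr px; rewrite -mulrA; apply: IM.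
Qed.

Lemma ideal_pow_sat I J n p : ideal_pow I n p -> sat_pow I J n p.
Proof.
have [_ _ IM] := ideal_pow_ideal I n.
by move=> Ip; exists 0%N => q _; rewrite mulrC; apply: IM.
Qed.

Lemma mono_mem_colon A B nu : is_ideal A -> supp_closed B ->
    (forall mu, B 'X_[mu] -> A 'X_[nu + mu]) ->
  colon A B 'X_[nu].
Proof.
move=> idA cB nuA q Bq; rewrite [q]mpolyE mulr_sumr big_seq.
apply: ideal_sum => // mu muq; rewrite -scalerAr -mpolyXD; apply: idealZ => //.
by apply: nuA; apply: cB muq.
Qed.

Lemma sat_pow_supp_closed I J n : supp_closed I -> supp_closed J ->
  supp_closed (sat_pow I J n).
Proof.
move=> cI cJ p nu [r pr] nup; exists r.
apply: mono_mem_colon (ideal_pow_supp_closed cJ) _ => [|mu Jmu].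
  exact: ideal_pow_ideal.
have := pr _ Jmu; move/(ideal_pow_supp_closed cI); apply.
by rewrite addmC (perm_mem (msuppMX _ _)) map_f.
Qed.

Definition truncm nu a : 'X_{1..m} := [multinom minn (nu i) (a i) | i < m].

Lemma truncm_lel nu a : (truncm nu a <= nu)%MM.
Proof. by apply/mnm_lepP => i; rewrite mnmE geq_minl. Qed.

Lemma truncm_ler nu a : (truncm nu a <= a)%MM.
Proof. by apply/mnm_lepP => i; rewrite mnmE geq_minr. Qed.

(** For a monomial ideal this says that every minimal generator divides ['X_[a]]. *)
Definition trunc_closed A a : Prop :=
  forall nu, A 'X_[nu] -> A 'X_[truncm nu a].

Lemma exists_min_gen_monomial I nu : I 'X_[nu] ->
  exists2 mu, min_gen_monomial I mu & (mu <= nu)%MM.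
Proof.
have [n] := ubnP (mdeg nu); elim: n nu => // n IH nu lt Inu.
case: (classic (min_gen_monomial I nu)) => [|nmin]; first by exists nu; rewrite ?lepm_refl.
have [mu [Imu le ne]] : exists mu, [/\ I 'X_[mu], (mu <= nu)%MM & mu <> nu].
  apply: NNPP => nex; apply: nmin; split=> // mu Imu le.
  by apply: NNPP => ne; apply: nex; exists mu.
have lt' : (mdeg mu < mdeg nu)%N.
  rewrite -(submK le) mdegD -[X in (X < _)%N]add0n ltn_add2r lt0n mdeg_eq0.
  by apply: contra_notN ne => /eqP e; rewrite -(submK le) e add0m.
have [|rho rmin rle] := IH mu _ Imu; first exact: leq_trans lt' lt.
by exists rho => //; apply: lepm_trans rle le.
Qed.

Lemma trunc_closed_lcm I (gens : seq 'X_{1..m}) : is_ideal I ->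
    (forall mu, mu \in gens <-> min_gen_monomial I mu) ->
  trunc_closed I (lcm_mono gens).
Proof.
move=> idI gensP nu /exists_min_gen_monomial[mu mumin munu].
apply: ideal_mono_le (mumin.1) => //; apply/mnm_lepP => i; rewrite !mnmE leq_min.
rewrite (mnm_lepP munu) /= (big_rem mu) ?leq_maxl //=.
exact/gensP.
Qed.

(** Each of the [n] factors from [I] is truncated at [a]; their product divides both the given
    monomial and ['X_[a *+ n]]. *)
Lemma trunc_closed_pow I a n : supp_closed I -> trunc_closed I a ->
  trunc_closed (ideal_pow I n) (a *+ n).
Proof.
move=> cI tI nu Inu.
have [|t [<- tI' tle]] := ideal_pow_msupp cI Inu (nu := nu).
  by rewrite msuppX mem_head.
rewrite -(size_map (truncm^~ a)); apply: ideal_pow_mono => [u /mapP[v /tI' /tI vI ->] //|].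
apply/mnm_lepP => i; rewrite mnmE mulmnE leq_min big_map mnm_sumE.
have := mnm_lepP tle i; rewrite mnm_sumE => h; apply/andP; split.
  by apply: leq_trans h; apply: leq_sum => u _; apply: (mnm_lepP (truncm_lel u a)).
rewrite size_map -sum1_size big_distrr /=; apply: leq_sum => u _.
by rewrite muln1; apply: (mnm_lepP (truncm_ler u a)).
Qed.

(** The truncation of [nu + mu] divides [truncm nu a + mu], so the same exponent [r] serves. *)
Lemma trunc_closed_sat I J a n : supp_closed J ->
    trunc_closed (ideal_pow I n) a -> trunc_closed (sat_pow I J n) a.
Proof.
move=> cJ tI nu [r nur]; exists r.
apply: mono_mem_colon (ideal_pow_supp_closed cJ) _ => [|mu Jmu].
  exact: ideal_pow_ideal.
have := nur _ Jmu; rewrite -mpolyXD => /tI; apply: ideal_mono_le.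
  exact: ideal_pow_ideal.
apply/mnm_lepP => i; rewrite !mnmE; lia.
Qed.

(** Otherwise [I] lies in the prime generated by the [m - #|F| < h] variables outside [F], to which
    no chain of length [h] leads. *)
Lemma height_supp I h (F : {set 'I_m}) : supp_closed I -> ht_ge I h ->
    (m < #|F| + h)%N ->
  exists2 u : 'X_{1..m}, I 'X_[u] & forall j, j \notin F -> u j = 0%N.
Proof.
move=> cI htI lt; apply: NNPP => nex.
have /prime_chain_to_var_prime : prime_chain_to (var_prime (~: F)) h.
  apply: htI => [|p Ip nu nuF]; first exact: var_prime_prime.
  apply: memN_msupp_eq0; apply/negP => nup; apply: nex.
  by exists nu => [|j jF]; [apply: cI nup | apply: nuF; rewrite inE].
by have := cardsC F; rewrite card_ord; lia.
Qed.

Lemma height_le_mdeg I a h : is_ideal I -> supp_closed I -> trunc_closed I a ->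
  is_height I h -> (h <= mdeg a)%N.
Proof.
move=> [_ _ IM] cI tI [htI nht].
(* No prime contains the unit ideal, so [ht_ge] would hold vacuously at [h.+1], against [nht]. *)
have nI1 : ~ I 1.
  move=> I1; apply: nht => P [_ P1 _] IP; case: P1; exact: IP.
pose S := [set j | (0 < a j)%N].
have /prime_chain_to_var_prime le : prime_chain_to (var_prime S) h.
  apply: htI => [|p Ip nu nuS]; first exact: var_prime_prime.
  apply: memN_msupp_eq0; apply/negP => nup; apply: nI1.
  have := tI _ (cI _ _ Ip nup); congr I; rewrite -mpolyX0; congr 'X_[_].
  apply/mnmP => j; rewrite mnmE mnm0E.
  by have [aj|] := posnP (a j); [rewrite aj minn0 | move=> aj; rewrite nuS ?min0n ?inE].
apply: leq_trans le _; rewrite mdegE -sum1_card [leqRHS](bigID (mem S)) /=.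
by apply: leq_trans (leq_addr _ _); apply: leq_sum => j; rewrite inE.
Qed.

End Ideals.

(** * Vanishing of Cech cohomology *)

Section Cech.
Variables (k : fieldType) (m : nat).
Local Notation R := {mpoly k[m]}.
Implicit Types (F G : {set 'I_m}) (j v : 'I_m).

Definition cech_sign j G : k := (-1) ^+ #|[set l in G | (l < j)%N]|.

Lemma cech_sign_rem j G l : l \in G ->
  cech_sign j G = (-1) ^+ (l < j)%N * cech_sign j (G :\ l).
Proof.
move=> lG; rewrite /cech_sign -exprD; congr (_ ^+ _).
rewrite (cardsD1 l) !inE lG /=; congr (_ + _)%N; apply: eq_card => x.
by rewrite !inE andbA.
Qed.

Lemma cech_sign_sqr j G : cech_sign j G * cech_sign j G = 1.
Proof. by rewrite -expr2 sqrr_sign. Qed.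

(* Contracting homotopy of the full simplex, with apex [v]. *)
Definition cech_cone (v : 'I_m) (e : {set 'I_m} -> k) F : k :=
  if v \in F then 0 else cech_sign v F * e (v |: F).

(** If [v] is in [F], only the term [j = v] survives. Otherwise the cocycle condition on [v |: F]
    expresses [e F] through the other faces, and the signs match because exactly one of [j < v] and
    [v < j] holds. *)
Lemma cech_cone_homotopy v (e : {set 'I_m} -> k) F :
    (forall G, \sum_(j in G) cech_sign j G * e (G :\ j) = 0) ->
  \sum_(j in F) cech_sign j F * cech_cone v e (F :\ j) = e F.
Proof.
move=> ce; have [vF|vF] := boolP (v \in F).
  rewrite (bigD1 v) //= big1 ?addr0 => [|j /andP[jF jv]].
    rewrite /cech_cone !inE eqxx /= setD1K // mulrA (cech_sign_rem _ vF) ltnn.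
    by rewrite mul1r cech_sign_sqr mul1r.
  by rewrite /cech_cone !inE eq_sym jv vF mulr0.
have := ce (v |: F); rewrite (bigD1 v) ?setU11 //= setU1K //.
rewrite (cech_sign_rem _ (setU11 v F)) ltnn setU1K // mul1r => /eqP.
rewrite addr_eq0 => /eqP eF.
rewrite -[RHS]mul1r -(cech_sign_sqr v F) -mulrA eF mulrN -mulNr mulr_sumr.
rewrite [RHS](eq_bigl (fun j => j \in F)) => [|j]; last first.
  by rewrite !inE; case: eqP => [->|_]; rewrite ?(negPf vF) //= andbT.
apply: eq_bigr => j jF; have jv : j != v by apply: contraNneq vF => <-.
rewrite /cech_cone !inE (negPf vF) andbF.
have -> : (v |: F) :\ j = v |: (F :\ j).
  by apply/setP => x; rewrite !inE; have [->|] := eqVneq x v; rewrite // eq_sym jv.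
rewrite (cech_sign_rem v jF) (cech_sign_rem j (setU11 v F)) setU1K //.
rewrite !mulrA; congr (_ * _).
have zw : (-1) ^+ (j < v)%N * (-1) ^+ (v < j)%N = -1 :> k.
  rewrite -signr_addb; have : j != v :> nat by [].
  by case: ltngtP.
by rewrite -mulrA mulNr mulrACA zw mulN1r opprK mulrC.
Qed.

Lemma xFE F : xF k F = 'X_[mesym1 F].
Proof.
rewrite /xF mpolyXE_id big_mkcond; apply: eq_bigr => j _; rewrite mnmE.
by case: (j \in F).
Qed.

Variables (E : R -> Prop) (a : 'X_{1..m}) (h : nat).
Hypotheses (idE : is_ideal E) (cE : supp_closed E) (tE : trunc_closed E a).
Hypothesis hE : forall F, (m < #|F| + h)%N ->
  exists2 u : 'X_{1..m}, E 'X_[u] & forall j, j \notin F -> u j = 0%N.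
Hypothesis ha : (h <= mdeg a)%N.

Variables (i : nat) (r : int) (c : {set 'I_m} -> R) (t : nat).
Hypothesis cc : cochain E (fun n => n == i) r c t.
Hypothesis dc : forall G, cech_d c t G = 0.
Hypothesis ri : (mdeg a)%:Z - h%:Z + 1 < r + i%:Z.

(* [common_coef beta F] is the coefficient of [c F / x_F^t] in multidegree
   [beta - (t, ..., t)]: all fractions are put over [(x_1 ... x_m)^t]. *)
Definition common_coef (beta : 'X_{1..m}) F : k :=
  (c F * 'X_[mesym1 (~: F) *+ t])@_beta.

(** The cocycle identity at [G] is multiplied by the [t]-th power of the variables outside [G]; with
    ['X_j ^+ t] this gives those outside [G :\ j]. *)
Lemma common_coef_cocycle beta G :
  \sum_(j in G) cech_sign j G * common_coef beta (G :\ j) = 0.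
Proof.
have := congr1 (fun p => (p * 'X_[mesym1 (~: G) *+ t])@_beta) (dc G).
rewrite mul0r mcoeff0 /cech_d mulr_suml raddf_sum /= => dG; rewrite -[RHS]dG.
apply: eq_bigr => j jG; rewrite /common_coef -mcoeffCM; congr (_@__).
rewrite /cech_sign rmorphXn rmorphN rmorph1 /= -!mulrA; congr (_ * (_ * _)).
rewrite mpolyXn -mpolyXD; congr 'X_[_].
apply/mnmP => l; rewrite mnmDE !mulmnE !mnmE !inE -mulnDl; congr (_ * _)%N.
by have [<-|_] := eqVneq j l; rewrite ?jG.
Qed.

Lemma common_coef_neq0 beta F : common_coef beta F != 0 ->
  exists nu : 'X_{1..m}, [/\ E 'X_[nu], #|F| = i,
    (mdeg nu)%:Z = r + (t * i)%N%:Z & beta = (mesym1 (~: F) *+ t + nu)%MM].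
Proof.
rewrite -mcoeff_msupp (perm_mem (msuppMX _ _)) => /mapP[nu nuc ->].
have [c0 Ec hc] := cc F.
have Fi : #|F| == i by apply: contraLR nuc => /c0 ->; rewrite msupp0.
exists nu; split=> //; [exact: cE nuc | exact/eqP |].
case: hc => [cF0|[d [dE /dhomogP hd]]]; first by move: nuc; rewrite cF0 msupp0.
by rewrite -(eqP Fi) -dE (hd _ nuc).
Qed.

(* A vertex of the second kind is an apex only in cohomological degrees above
   [m - h + 1], which [ri] guarantees when there is none of the first kind. *)
Definition cone_vertex (beta : 'X_{1..m}) : option 'I_m :=
  if [pick v | (t + a v <= beta v)%N] is Some v then Some v
  else [pick v | (t <= beta v)%N].

(** A nonzero coefficient with all [beta j < t] forces [F] to be full and [i = m]. All coordinates
    of the multidegree are then negative, so [r + i <= 0], which contradicts [ri] and [ha]. *)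
Lemma cone_vertexN beta F : cone_vertex beta = None -> common_coef beta F = 0.
Proof.
rewrite /cone_vertex; case: pickP => // _; case: pickP => // small _.
apply/eqP; apply: contraT => /common_coef_neq0[nu [_ Fi nud betaE]].
have FT : F = setT.
  apply/setP => j; rewrite inE; apply: contraFT (small j) => jF.
  by rewrite betaE mnmDE mulmnE mnmE inE jF mul1n leq_addr.
have im : i = m by rewrite -Fi FT cardsT card_ord.
have nuE : nu = beta.
  by rewrite betaE FT; apply/mnmP => j; rewrite mnmDE mulmnE mnmE !inE.
have : (mdeg nu + m <= t * m)%N.
  rewrite mdegE -[X in (_ + X)%N]card_ord -sum1_card -big_split /=.
  rewrite -[X in (_ <= _ * X)%N]card_ord -sum1_card big_distrr /=.
  by apply: leq_sum => j _; rewrite muln1 addn1 nuE ltnNge small.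
move: nud ri ha; rewrite im; lia.
Qed.

Definition cone_coef beta F : k :=
  if cone_vertex beta is Some v then cech_cone v (common_coef beta) F else 0.

Lemma cone_coef_boundary beta F :
  \sum_(j in F) cech_sign j F * cone_coef beta (F :\ j) = common_coef beta F.
Proof.
rewrite /cone_coef; case Ev: (cone_vertex beta) => [v|].
  by apply: cech_cone_homotopy => G; apply: common_coef_cocycle.
by rewrite cone_vertexN // big1 // => j _; rewrite mulr0.
Qed.

(** Numerator of the cone over the denominator [x_F^(t + mdeg a)]; the extra [mdeg a] makes the
    exponents on [F] at least those of [a]. *)
Definition cone_mono beta F : 'X_{1..m} :=
  (beta - mesym1 (~: F) *+ t + mesym1 F *+ mdeg a)%MM.

Lemma le_mdeg (u : 'X_{1..m}) j : (u j <= mdeg u)%N.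
Proof. by rewrite mdegE (bigD1 j) //= leq_addr. Qed.

Lemma cone_coef_neq0 beta F : cone_coef beta F != 0 ->
  [/\ #|F|.+1 = i, (mesym1 (~: F) *+ t <= beta)%MM, E 'X_[cone_mono beta F]
    & (mdeg (cone_mono beta F))%:Z = r + ((t + mdeg a) * #|F|)%N%:Z].
Proof.
rewrite /cone_coef; case Ev: (cone_vertex beta) => [v|]; last by rewrite eqxx.
rewrite /cech_cone; case: ifPn => vF; first by rewrite eqxx.
rewrite mulf_eq0 negb_or => /andP[_ /common_coef_neq0[nu [Enu Fi nud betaE]]].
have Fi' : #|F|.+1 = i by rewrite -Fi cardsU1 vF.
have vt : (t <= beta v)%N.
  move: Ev; rewrite /cone_vertex; case: pickP => [w le [<-]|_].
    by apply: leq_trans le; rewrite leq_addr.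
  by case: pickP => // w le [<-].
have betaj j : j != v -> beta j = ((j \notin F) * t + nu j)%N.
  by move=> jv; rewrite betaE mnmDE mulmnE mnmE !inE (negPf jv).
have betav : beta v = nu v.
  by rewrite betaE mnmDE mulmnE mnmE !inE eqxx.
have le : (mesym1 (~: F) *+ t <= beta)%MM.
  apply/mnm_lepP => j; rewrite mulmnE mnmE inE; have [->|jv] := eqVneq j v.
    by rewrite vF mul1n.
  by rewrite betaj // leq_addr.
have mF := cardsC F; rewrite card_ord in mF.
have mdegb : (mdeg beta)%:Z = r + (t * m)%N%:Z.
  rewrite betaE mdegD mdegMn mdeg_mesym1 PoszD nud.
  have : (t * m = t * i + t * #|~: (v |: F)|)%N by rewrite -mulnDr -Fi cardsC card_ord.
  move: #|~: (v |: F)| => z; lia.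
split=> //; last first.
  rewrite /cone_mono mdegD mdegMn mdeg_mesym1.
  have := congr1 mdeg (submK le); rewrite mdegD mdegMn mdeg_mesym1. nia.
have monoj j : cone_mono beta F j = (beta j - (j \notin F) * t + (j \in F) * mdeg a)%N.
  by rewrite mnmDE mnmBE !mulmnE !mnmE inE.
(* For an apex of the first kind the exponent at [v] is at least [a v], so the truncation of [nu]
   divides the monomial whatever [nu v] is. *)
have [big|small] := boolP [exists w, t + a w <= beta w]%N.
  have va : (t + a v <= beta v)%N.
    move: Ev; rewrite /cone_vertex; case: pickP => [w le' [<-] //|none].
    by case/existsP: big => w; rewrite none.
  apply: ideal_mono_le (tE Enu) => //; apply/mnm_lepP => j; rewrite mnmE monoj.
  have [->|jv] := eqVneq j v; first by rewrite vF (negPf vF); lia.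
  by rewrite betaj // addKn; lia.
(* Now [beta j < t + a j] for all [j], whence [r + m <= mdeg a]. With [i = #|F| + 1], [ri] gives
   [m < #|F| + h], and [hE] supplies a monomial supported on [F]. *)
have bsmall : (mdeg beta + m <= t * m + mdeg a)%N.
  rewrite !mdegE -{1}[X in (_ + X <= _)%N]card_ord -sum1_card -big_split /=.
  rewrite -[X in (_ <= _ * X + _)%N]card_ord -sum1_card big_distrr -big_split /=.
  apply: leq_sum => j _; rewrite muln1 addn1 ltnNge.
  by move: small; rewrite negb_exists => /forallP.
have [|u Eu uF] := hE (F := F); first by move: mdegb ri; rewrite -Fi'; lia.
apply: ideal_mono_le (tE Eu) => //; apply/mnm_lepP => j; rewrite mnmE monoj.
case: (boolP (j \in F)) => jF; last by rewrite uF // min0n.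
by rewrite /= mul1n; have := le_mdeg a j; lia.
Qed.

Definition common_supp : seq 'X_{1..m} :=
  undup (flatten [seq msupp (c F * 'X_[mesym1 (~: F) *+ t]) | F : {set 'I_m}]).

Definition cone_cochain F : R :=
  \sum_(beta <- common_supp) cone_coef beta F *: 'X_[cone_mono beta F].

Lemma cone_cochainP : cochain E (fun n => n.+1 == i) r cone_cochain (t + mdeg a).
Proof.
have [E0 _ _] := idE; move=> F; split.
- move=> Fi; apply: big1 => beta _.
  have [->|/cone_coef_neq0[Fi' _ _ _]] := eqVneq (cone_coef beta F) 0.
    by rewrite scale0r.
  by rewrite Fi' eqxx in Fi.
- apply: ideal_sum => // beta _.
  have [->|/cone_coef_neq0[_ _ Emu _]] := eqVneq (cone_coef beta F) 0.
    by rewrite scale0r.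
  exact: idealZ.
have [/hasP[beta0 _ /cone_coef_neq0[_ _ _ d0]]|none] :=
  boolP (has (fun beta => cone_coef beta F != 0) common_supp); last first.
  left; rewrite /cone_cochain big_seq big1 // => beta bS.
  by move/hasPn/(_ _ bS): none; rewrite negbK => /eqP ->; rewrite scale0r.
right; exists (mdeg (cone_mono beta0 F)); split=> //.
apply: rpred_sum => beta _.
have [->|/cone_coef_neq0[_ _ _ d]] := eqVneq (cone_coef beta F) 0.
  by rewrite scale0r rpred0.
by apply: rpredZ; rewrite dhomogX /=; apply/eqP; move: d0 d; lia.
Qed.

(** This matches the factor ['X_j] raised to [t + mdeg a] in the differential: [t] undoes the
    subtraction at [j], exact because [t <= beta j], and [mdeg a] accounts for [j] entering [F]. *)
Lemma cone_mono_rem beta F j : j \in F -> cone_coef beta (F :\ j) != 0 ->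
  (cone_mono beta (F :\ j) + U_(j) *+ (t + mdeg a) = cone_mono beta F)%MM.
Proof.
move=> jF /cone_coef_neq0[_ /mnm_lepP/(_ j) + _ _].
rewrite mulmnE mnmE !inE eqxx mul1n => tj.
apply/mnmP => l; rewrite !mnmDE !mnmBE !mulmnE !mnmE !inE.
have [<-|_] := eqVneq j l; last by rewrite addn0.
by rewrite jF /=; lia.
Qed.

(** Multiplied by ['X_[mesym1 (~: F) *+ t]], this is the monomial expansion of the polynomial whose
    coefficients are [common_coef], shifted by [mesym1 F *+ mdeg a]. *)
Lemma common_coef_expand F :
  \sum_(beta <- common_supp) common_coef beta F *: 'X_[cone_mono beta F] =
  c F * 'X_[mesym1 F *+ mdeg a].
Proof.
have XF0 : 'X_[mesym1 (~: F) *+ t] != 0 :> R.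
  by rewrite -msupp_eq0 msuppX.
apply: (mulIf XF0); rewrite mulrAC mulr_suml.
set p := c F * 'X_[mesym1 (~: F) *+ t].
have pS : p = \sum_(beta <- common_supp) p@_beta *: 'X_[beta].
  rewrite [LHS]mpolyE [RHS](bigID (mem (msupp p))) /= [X in _ + X]big1 ?addr0.
    rewrite -[RHS]big_filter; apply: perm_big; apply: uniq_perm.
    - exact: msupp_uniq.
    - by rewrite filter_uniq // undup_uniq.
    move=> beta; rewrite mem_filter; case: (boolP (beta \in msupp p)) => //= bp.
    rewrite mem_undup; symmetry; apply/flattenP; exists (msupp p) => //.
    by apply/mapP; exists F; rewrite ?mem_enum.
  by move=> beta /memN_msupp_eq0 ->; rewrite scale0r.
rewrite {1}pS mulr_suml; apply: eq_bigr => beta _; rewrite -!scalerAl.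
have [c0|c0] := eqVneq (common_coef beta F) 0; first by rewrite c0 [p@_beta]c0 !scale0r.
rewrite -[p@_beta]/(common_coef beta F); congr (_ *: _); rewrite -!mpolyXD.
congr 'X_[_]; rewrite /cone_mono -addmA [(_ *+ mdeg a + _)%MM]addmC addmA submK //.
by have [nu [_ _ _ ->]] := common_coef_neq0 c0; apply: lem_addr.
Qed.

Lemma cone_cochain_boundary F :
  c F * xF k F ^+ (t + mdeg a) =
  cech_d cone_cochain (t + mdeg a) F * xF k F ^+ t.
Proof.
rewrite xFE exprD mulrCA mulrC mpolyXn -common_coef_expand mpolyXn; congr (_ * _).
rewrite /cech_d.
(* In each multidegree the coefficient is the boundary of the cone; exchanging sums assembles the
   boundary of [cone_cochain]. *)
under eq_bigr => beta _ do rewrite -cone_coef_boundary scaler_suml.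
rewrite exchange_big /=; apply: eq_bigr => j jF.
rewrite /cone_cochain -mulrA mulr_suml mulr_sumr; apply: eq_bigr => beta _.
have [->|g0] := eqVneq (cone_coef beta (F :\ j)) 0.
  by rewrite mulr0 !scale0r mul0r mulr0.
rewrite -(cone_mono_rem jF g0) mpolyXD -mpolyXn -scalerAl -scalerA.
by rewrite -[LHS]mul_mpolyC rmorphXn rmorphN rmorph1.
Qed.

End Cech.

(** * The regularity bound *)

Lemma reg_le_trunc_closed (k : fieldType) (m : nat) (E : {mpoly k[m]} -> Prop)
    (a : 'X_{1..m}) (h : nat) :
    is_ideal E -> supp_closed E -> trunc_closed E a ->
    (forall F : {set 'I_m}, (m < #|F| + h)%N ->
      exists2 u : 'X_{1..m}, E 'X_[u] & forall j, j \notin F -> u j = 0%N) ->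
    (h <= mdeg a)%N ->
  reg_le E ((mdeg a)%:Z - h%:Z + 1).
Proof.
move=> idE cE tE hE ha i r [c [t [cc dc ncob]]]; rewrite leNgt; apply/negP => ri.
case: ncob; exists (cone_cochain a c t), (t + mdeg a)%N; split.
  exact: cone_cochainP cc ri.
by move=> F; apply: cone_cochain_boundary cc dc ri F.
Qed.

Theorem theorem2p9 (k : fieldType) (m : nat) (I J : {mpoly k[m]} -> Prop)
    (gens : seq 'X_{1..m}) (h : nat) :
  monomial_ideal I -> monomial_ideal J ->
  (forall mu, mu \in gens <-> min_gen_monomial I mu) ->
  is_height I h ->
  forall n : nat, (1 <= n)%N ->
    reg_le (sat_pow I J n)
      ((mdeg (lcm_mono gens) * n)%N%:Z - h%:Z + 1).
Proof.
move=> mI mJ gensP hI n n1; have [idI _] := mI.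
have cI := monomial_ideal_supp_closed mI; have cJ := monomial_ideal_supp_closed mJ.
have tI := trunc_closed_lcm idI gensP.
rewrite -mdegMn; apply: reg_le_trunc_closed.
- exact: sat_pow_ideal.
- exact: sat_pow_supp_closed.
- exact/trunc_closed_sat/trunc_closed_pow.
(* The [n]-th power of a monomial of [I] supported on [F] lies in [I^n] and has its support in [F]
   too. *)
- move=> F /(height_supp cI hI.1)[u Iu uF]; exists (u *+ n)%MM.
    apply: ideal_pow_sat; rewrite -[in ideal_pow _ _](size_nseq n u).
    apply: ideal_pow_mono => [v /nseqP[-> _] //|].
    by rewrite big_nseq -Monoid.iteropE lepm_refl.
  by move=> j /uF uj; rewrite mulmnE uj.
rewrite mdegMn; apply: leq_trans (height_le_mdeg idI cI tI hI) _.
by rewrite leq_pmulr.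
Qed.
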